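(* The first-order theory $SAPP$ is not finitely axiomatizable.
   Context: Let $\mathcal{L}$ be the first-order language with a binary predicate symbol $O$ (meaning perpendicularity of lines) and equality $=$ (interpreted as true equality), without constants and function symbols. $SAPP$ is the theory in $\mathcal{L}$ consisting of the following formulas: $\lambda_{1n}$ (for each $n\ge 1$): $\forall y_1\ldots\forall y_n\forall s\,(O(s,y_1)\wedge\ldots\wedge O(s,y_n)\rightarrow\exists t\,(t\neq y_1\wedge\ldots\wedge t\neq y_n\wedge O(s,t)))$; $\lambda_{2n}$ (for each $n\ge 2$): $\forall y_1\ldots\forall y_n\exists s\,(\neg O(s,y_1)\wedge\ldots\wedge\neg O(s,y_n))$; $\lambda_3$: $\forall x\,\neg O(x,x)$; $\lambda_4$: $\forall x\forall y\,(O(x,y)\rightarrow O(y,x))$; $\lambda_5$: $\forall x\exists y\,O(x,y)$; $\lambda_6$: $\forall x\forall y\forall z\forall t\,(O(x,z)\wedge O(y,z)\wedge O(x,t)\rightarrow O(y,t))$. A theory is finitely axiomatizable if there is a finite set of closed formulas of its language having exactly the same models. *)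

(* Defs.v *)
From Stdlib Require Import Arith List.

(* First-order formulas over one binary predicate [O] and equality; there are
   no constants or function symbols, so terms are just variables, named by
   natural numbers. *)
Inductive formula : Type :=
| Eq (x y : nat)
| O (x y : nat)
| Not (p : formula)
| And (p q : formula)
| Or (p q : formula)
| Imp (p q : formula)
| All (x : nat) (p : formula)
| Ex (x : nat) (p : formula).

Fixpoint free (z : nat) (p : formula) : Prop :=
  match p with
  | Eq x y | O x y => z = x \/ z = y
  | Not p => free z p
  | And p q | Or p q | Imp p q => free z p \/ free z q
  | All x p | Ex x p => z <> x /\ free z p
  end.

Definition closed (p : formula) : Prop := forall z, ~ free z p.

Record structure : Type := Structure {
  domain : Type;
  domain_inhabited : inhabited domain;
  perp : domain -> domain -> Prop
}.

Definition update {A : Type} (v : nat -> A) (x : nat) (a : A) : nat -> A :=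
  fun z => if Nat.eqb z x then a else v z.

Fixpoint sat (M : structure) (v : nat -> domain M) (p : formula) : Prop :=
  match p with
  | Eq x y => v x = v y
  | O x y => perp M (v x) (v y)
  | Not p => ~ sat M v p
  | And p q => sat M v p /\ sat M v q
  | Or p q => sat M v p \/ sat M v q
  | Imp p q => sat M v p -> sat M v q
  | All x p => forall a, sat M (update v x a) p
  | Ex x p => exists a, sat M (update v x a) p
  end.

Definition holds (M : structure) (p : formula) : Prop := forall v, sat M v p.

Definition theory : Type := formula -> Prop.

Definition model (M : structure) (T : theory) : Prop :=
  forall p, T p -> holds M p.

Definition finitely_axiomatizable (T : theory) : Prop :=
  exists l : list formula,
    (forall p, In p l -> closed p) /\
    (forall M : structure, model M (fun p => In p l) <-> model M T).

(* [f 1 /\ f 2 /\ ... /\ f n], for n >= 1. *)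
Definition conj_upto (f : nat -> formula) (n : nat) : formula :=
  fold_left (fun p i => And p (f i)) (seq 2 (n - 1)) (f 1).

(* The variable y_i is [i]; [all_upto n p] is: forall y_1 ... y_n, p. *)
Definition all_upto (n : nat) (p : formula) : formula :=
  fold_right All p (seq 1 n).

Definition lambda1 (n : nat) : formula :=
  let s := 0 in
  let t := n + 1 in
  all_upto n (All s
    (Imp (conj_upto (fun i => O s i) n)
         (Ex t (And (conj_upto (fun i => Not (Eq t i)) n) (O s t))))).

Definition lambda2 (n : nat) : formula :=
  let s := 0 in
  all_upto n (Ex s (conj_upto (fun i => Not (O s i)) n)).

Definition lambda3 : formula := All 0 (Not (O 0 0)).

Definition lambda4 : formula := All 0 (All 1 (Imp (O 0 1) (O 1 0))).

Definition lambda5 : formula := All 0 (Ex 1 (O 0 1)).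

Definition lambda6 : formula :=
  let x := 0 in let y := 1 in let z := 2 in let t := 3 in
  All x (All y (All z (All t
    (Imp (And (And (O x z) (O y z)) (O x t)) (O y t))))).

Inductive SAPP : theory :=
| SAPP1 n : 1 <= n -> SAPP (lambda1 n)
| SAPP2 n : 2 <= n -> SAPP (lambda2 n)
| SAPP3 : SAPP lambda3
| SAPP4 : SAPP lambda4
| SAPP5 : SAPP lambda5
| SAPP6 : SAPP lambda6.

(* Main.v *)
Require Import Defs.
From Stdlib Require Import Arith List Lia Classical FunctionalExtensionality.
From Stdlib Require Fin.

(** The argument is a back-and-forth between two structures of the same shape.
    Lines are indexed by a pair of mutually perpendicular directions (there are
    infinitely many such pairs), a side of that pair, and a position among the
    parallel lines of that direction, taken in a type [A].  When [A] is
    infinite this is a model of [SAPP] ([sapp_model]).  When [A] is finite it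
    is not: the axiom [lambda1 n] breaks as soon as [n] variables can list a
    whole class of parallel lines ([lambda1_fails]).

    A formula whose variables all lie below [N] can only talk about [N] lines
    at a time, since quantifying over a variable forgets its former value.  If
    each parallel class has more than [N] lines, there is always an unused line
    with any prescribed relation to the lines currently named, so such a
    formula cannot tell one [A] from another ([sat_similar]).  A finite list of
    axioms mentions finitely many variables, hence cannot separate the infinite
    [A] from a large enough finite one. *)

(** * Lines over a type of positions *)

(** [pencil] names two perpendicular directions at once and [side] chooses one
    of the two. *)
Record line (A : Type) : Type := Line {
  pencil : nat;
  side : bool;
  position : A
}.
Arguments Line {A}.
Arguments pencil {A}.
Arguments side {A}.
Arguments position {A}.

Definition perpendicular {A} (a b : line A) : Prop :=
  pencil a = pencil b /\ side a <> side b.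

Definition plane (A : Type) (a0 : A) : structure :=
  Structure (line A) (inhabits (Line 0 true a0)) perpendicular.

Definition more_than (n : nat) (A : Type) : Prop :=
  forall l : list A, length l <= n -> exists a, ~ In a l.

Lemma below_avoids (l : list nat) : exists k, k <= length l /\ ~ In k l.
Proof.
  apply NNPP; intros none.
  assert (incl (seq 0 (S (length l))) l) as sub.
  { intros k Hk; apply in_seq in Hk.
    apply NNPP; intros out; apply none; exists k; split; [lia | exact out]. }
  apply NoDup_incl_length in sub; [| apply seq_NoDup].
  rewrite length_seq in sub; lia.
Qed.

Lemma nat_more_than n : more_than n nat.
Proof.
  intros l _; destruct (below_avoids l) as [k [_ Hk]]; now exists k.
Qed.

(** Reducing modulo the size makes the enumeration total, and lets the indices
    [1, ..., S n] reach every element just as [0, ..., n] do. *)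
Definition fin_enum (n i : nat) : Fin.t (S n) :=
  Fin.of_nat_lt (Nat.mod_upper_bound i (S n) (Nat.neq_succ_0 n)).

Definition fin_val {n} (a : Fin.t n) : nat := proj1_sig (Fin.to_nat a).

Lemma fin_val_enum n i : fin_val (fin_enum n i) = i mod S n.
Proof. unfold fin_val, fin_enum; now rewrite Fin.to_nat_of_nat. Qed.

Lemma fin_more_than n : more_than n (Fin.t (S n)).
Proof.
  intros l Hl; destruct (below_avoids (map fin_val l)) as [k [Hk out]].
  rewrite length_map in Hk.
  exists (fin_enum n k); intros Hin; apply out.
  rewrite <- (Nat.mod_small k (S n)) by lia.
  rewrite <- fin_val_enum; now apply in_map.
Qed.

Lemma fin_enum_onto n (a : Fin.t (S n)) :
  exists i, 1 <= i <= S n /\ fin_enum n i = a.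
Proof.
  assert (fin_val a < S n) as Ha by apply (proj2_sig (Fin.to_nat a)).
  assert (forall i, i mod S n = fin_val a -> fin_enum n i = a) as found.
  { intros i Hi; apply Fin.to_nat_inj.
    change (fin_val (fin_enum n i) = fin_val a); now rewrite fin_val_enum. }
  destruct (Nat.eq_dec (fin_val a) 0) as [H0 | H0].
  - exists (S n); split; [lia | apply found].
    now rewrite Nat.Div0.mod_same.
  - exists (fin_val a); split; [lia | apply found; now apply Nat.mod_small].
Qed.

(** * Indistinguishability by formulas with few variables *)

Fixpoint max_var (p : formula) : nat :=
  match p with
  | Eq x y | O x y => max x y
  | Not p => max_var p
  | And p q | Or p q | Imp p q => max (max_var p) (max_var q)
  | All x p | Ex x p => max x (max_var p)
  end.

(** Besides equality and perpendicularity, belonging to the same pencil has to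
    be preserved: two distinct parallel lines and two lines of different pencils satisfy
    the same atomic formulas, but only the former have a common
    perpendicular. *)
Definition same_relations {A B} (a b : line A) (a' b' : line B) : Prop :=
  (a = b <-> a' = b') /\
  (pencil a = pencil b <-> pencil a' = pencil b') /\
  (perpendicular a b <-> perpendicular a' b').

Definition similar {A B} (N : nat)
    (v : nat -> line A) (w : nat -> line B) : Prop :=
  forall x y, x < N -> y < N -> same_relations (v x) (v y) (w x) (w y).

Lemma same_relations_refl {A B} (a : line A) (a' : line B) :
  same_relations a a a' a'.
Proof. unfold same_relations, perpendicular; tauto. Qed.

Lemma same_relations_sym {A B} (a b : line A) (a' b' : line B) :
  same_relations a b a' b' -> same_relations b a b' a'.
Proof.
  assert (forall C (c d : line C), perpendicular c d <-> perpendicular d c) as comm.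
  { unfold perpendicular; split; intros [E F]; split; auto. }
  unfold same_relations; rewrite (comm A b a), (comm B b' a').
  intros [He [Hp Ho]]; split; [| split]; [| | exact Ho]; split; intros E;
    symmetry; [apply He | apply He | apply Hp | apply Hp]; now symmetry.
Qed.

Lemma similar_sym {A B} N (v : nat -> line A) (w : nat -> line B) :
  similar N v w -> similar N w v.
Proof.
  intros H x y Hx Hy; specialize (H x y Hx Hy); unfold same_relations in *; tauto.
Qed.

Lemma similar_update {A B} N (v : nat -> line A) (w : nat -> line B) x a a' :
  similar N v w ->
  (forall y, y < N -> y <> x -> same_relations a (v y) a' (w y)) ->
  similar N (update v x a) (update w x a').
Proof.
  intros Hs Hn y z Hy Hz; unfold update.
  destruct (Nat.eqb_spec y x), (Nat.eqb_spec z x).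
  - apply same_relations_refl.
  - now apply Hn.
  - now apply same_relations_sym, Hn.
  - now apply Hs.
Qed.

(** The extension step of the back-and-forth.  If the new line [a] is already
    named, its counterpart is the line of the same name.  If it is a new line in
    the pencil of a named one, its counterpart lies in the corresponding pencil,
    on the side dictated by that named line, at an unused position.  Otherwise a
    line of an unused pencil answers it. *)
Lemma similar_extend {A B} N (v : nat -> line A) (w : nat -> line B) x a :
  more_than N B -> similar N v w ->
  exists a', similar N (update v x a) (update w x a').
Proof.
  intros HB Hs.
  enough (exists a', forall y, y < N -> y <> x ->
            same_relations a (v y) a' (w y)) as [a' Ha'].
  { exists a'; now apply similar_update. }
  destruct (classic (exists z, z < N /\ z <> x /\ v z = a))
    as [[z [Hz [_ <-]]] | new_line].
  { exists (w z); intros y Hy _; now apply Hs. }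
  assert (forall y, y < N -> y <> x -> a <> v y) as Hnew.
  { intros y Hy Hyx E; apply new_line; now exists y. }
  destruct (classic (exists z, z < N /\ z <> x /\ pencil (v z) = pencil a))
    as [[z [Hz [_ Ez]]] | new_pencil].
  - destruct (HB (map (fun y => position (w y)) (seq 0 N))) as [b Hb].
    { now rewrite length_map, length_seq. }
    (* the side of [w z], flipped exactly when [a] and [v z] differ in side *)
    exists (Line (pencil (w z))
              (xorb (side (w z)) (xorb (side (v z)) (side a))) b).
    intros y Hy Hyx.
    destruct (Hs z y Hz Hy) as [_ [Hp Ho]]; rewrite Ez in Hp.
    split; [| split]; simpl.
    + split; intros E; [now apply Hnew in E |].
      exfalso; apply Hb, in_map_iff; exists y.
      split; [now rewrite <- E | apply in_seq; lia].
    + exact Hp.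
    + unfold perpendicular in *; simpl; rewrite Ez in Ho.
      destruct (side a), (side (v z)), (side (v y)), (side (w z)), (side (w y));
        simpl; intuition congruence.
  - destruct (HB (map (fun y => position (w y)) (seq 0 N))) as [b _].
    { now rewrite length_map, length_seq. }
    destruct (nat_more_than N (map (fun y => pencil (w y)) (seq 0 N)))
      as [k Hk].
    { now rewrite length_map, length_seq. }
    exists (Line k true b); intros y Hy Hyx.
    assert (pencil a <> pencil (v y)) as Hp.
    { intros E; apply new_pencil; exists y; auto. }
    assert (k <> pencil (w y)) as Hp'.
    { intros ->; apply Hk, in_map_iff; exists y; split; [easy | apply in_seq; lia]. }
    assert (Line k true b <> w y) as He'.
    { intros E; apply Hp'; now rewrite <- E. }
    specialize (Hnew y Hy Hyx).
    unfold same_relations, perpendicular; simpl; tauto.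
Qed.

Lemma sat_similar {A B} (a0 : A) (b0 : B) N p :
  more_than N A -> more_than N B -> max_var p < N ->
  forall (v : nat -> line A) (w : nat -> line B), similar N v w ->
  (sat (plane A a0) v p <-> sat (plane B b0) w p).
Proof.
  intros HA HB; induction p as [x y | x y | p IH | p IHp q IHq | p IHp q IHq
    | p IHp q IHq | x p IH | x p IH]; simpl; intros Hb v w Hs.
  - apply (Hs x y); lia.
  - apply (Hs x y); lia.
  - rewrite (IH Hb v w Hs); tauto.
  - rewrite (IHp ltac:(lia) v w Hs), (IHq ltac:(lia) v w Hs); tauto.
  - rewrite (IHp ltac:(lia) v w Hs), (IHq ltac:(lia) v w Hs); tauto.
  - rewrite (IHp ltac:(lia) v w Hs), (IHq ltac:(lia) v w Hs); tauto.
  - specialize (IH ltac:(lia)); split; intros H a.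
    + destruct (similar_extend N w v x a HA (similar_sym N v w Hs)) as [b Hab].
      apply (IH _ _ (similar_sym N _ _ Hab)), H.
    + destruct (similar_extend N v w x a HB Hs) as [b Hab].
      apply (IH _ _ Hab), H.
  - specialize (IH ltac:(lia)); split; intros [a H].
    + destruct (similar_extend N v w x a HB Hs) as [b Hab].
      exists b; now apply (IH _ _ Hab).
    + destruct (similar_extend N w v x a HA (similar_sym N v w Hs)) as [b Hab].
      exists b; now apply (IH _ _ (similar_sym N _ _ Hab)).
Qed.

(** Inserting the positions of [A] into those of [B] by [f] turns any
    assignment over [A] into a similar one over [B], where [p] is known to
    hold. *)
Lemma holds_transfer {A B} (a0 : A) (b0 : B) (f : A -> B) N p :
  (forall a b, f a = f b -> a = b) ->
  more_than N A -> more_than N B -> max_var p < N ->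
  holds (plane B b0) p -> holds (plane A a0) p.
Proof.
  intros inj HA HB Hp Hold w.
  set (g := fun l : line A => Line (pencil l) (side l) (f (position l))).
  apply (sat_similar b0 a0 N p HB HA Hp (fun x => g (w x)) w);
    [| apply Hold].
  intros x y _ _; unfold same_relations, perpendicular, g; simpl.
  destruct (w x) as [i s a], (w y) as [j t b]; simpl.
  split; [| tauto].
  split; intros E; injection E.
  - intros Ef -> ->; now rewrite (inj a b Ef).
  - intros -> -> ->; reflexivity.
Qed.

(** * The axioms in the planes *)

Lemma update_same {X} (v : nat -> X) x : update v x (v x) = v.
Proof.
  apply functional_extensionality; intros z; unfold update.
  now destruct (Nat.eqb_spec z x) as [-> |].
Qed.

Lemma holds_All M x p : holds M (All x p) <-> holds M p.
Proof.
  split; intros H v.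
  - rewrite <- (update_same v x); apply (H v).
  - intros a; apply H.
Qed.

Lemma holds_all_upto M n p : holds M (all_upto n p) <-> holds M p.
Proof.
  unfold all_upto; induction (seq 1 n) as [| x l IH]; simpl; [tauto |].
  now rewrite holds_All.
Qed.

Lemma sat_conj_upto M v f n : 1 <= n ->
  (sat M v (conj_upto f n) <-> forall i, 1 <= i <= n -> sat M v (f i)).
Proof.
  intros Hn; unfold conj_upto.
  assert (forall l p, sat M v (fold_left (fun p i => And p (f i)) l p) <->
            sat M v p /\ forall i, In i l -> sat M v (f i)) as fold.
  { induction l as [| j l IH]; intros p; simpl.
    - firstorder.
    - rewrite IH; simpl; firstorder congruence. }
  rewrite fold; split.
  - intros [H1 H] i Hi; destruct (Nat.eq_dec i 1) as [-> |]; [easy |].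
    apply H, in_seq; lia.
  - intros H; split; [apply H; lia |].
    intros i Hi; apply in_seq in Hi; apply H; lia.
Qed.

Lemma holds_lambda1 M n : 1 <= n ->
  (holds M (lambda1 n) <->
   forall v : nat -> domain M, (forall i, 1 <= i <= n -> perp M (v 0) (v i)) ->
     exists t, (forall i, 1 <= i <= n -> t <> v i) /\ perp M (v 0) t).
Proof.
  intros Hn; unfold lambda1; rewrite holds_all_upto, holds_All.
  unfold holds; simpl.
  assert (forall (v : nat -> domain M) t,
    sat M (update v (n + 1) t) (conj_upto (fun i => Not (Eq (n + 1) i)) n) /\
      perp M (update v (n + 1) t 0) (update v (n + 1) t (n + 1)) <->
    (forall i, 1 <= i <= n -> t <> v i) /\ perp M (v 0) t) as body.
  { intros v t; rewrite sat_conj_upto by easy; simpl.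
    assert (update v (n + 1) t (n + 1) = t) as ->.
    { unfold update; now rewrite Nat.eqb_refl. }
    assert (forall i, i <= n -> update v (n + 1) t i = v i) as Hu.
    { intros i Hi; unfold update.
      destruct (Nat.eqb_spec i (n + 1)); [lia | easy]. }
    rewrite (Hu 0) by lia.
    split; intros [H H']; (split; [| exact H']); intros i Hi;
      specialize (H i Hi); [rewrite Hu in H by lia | rewrite Hu by lia]; easy. }
  pose proof (fun v => sat_conj_upto M v (fun i => O 0 i) n Hn) as premise.
  split; intros H v Hv.
  - destruct (H v (proj2 (premise v) Hv)) as [t Ht].
    exists t; now apply body.
  - destruct (H v (proj1 (premise v) Hv)) as [t Ht].
    exists t; now apply body.
Qed.

Lemma sapp_model {A} (a0 : A) : (forall n, more_than n A) ->
  model (plane A a0) SAPP.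
Proof.
  intros HA p [n Hn | n Hn | | | | ].
  - apply holds_lambda1; [easy |]; simpl; intros v Hv.
    destruct (HA n (map (fun i => position (v i)) (seq 1 n))) as [b Hb].
    { now rewrite length_map, length_seq. }
    exists (Line (pencil (v 0)) (negb (side (v 0))) b); split.
    + intros i Hi E; apply Hb, in_map_iff; exists i.
      split; [now rewrite <- E | apply in_seq; lia].
    + split; [easy | simpl; now destruct (side (v 0))].
  - unfold lambda2; apply holds_all_upto; intros v; simpl.
    destruct (nat_more_than n (map (fun i => pencil (v i)) (seq 1 n)))
      as [k Hk].
    { now rewrite length_map, length_seq. }
    exists (Line k true a0).
    apply (sat_conj_upto (plane A a0)); [lia |].
    intros i Hi; simpl; unfold update; simpl.
    destruct (Nat.eqb_spec i 0); [lia |].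
    intros [E _]; apply Hk, in_map_iff; exists i.
    split; [now rewrite <- E | apply in_seq; lia].
  - intros v a; simpl; unfold perpendicular; tauto.
  - intros v a b; simpl; unfold update, perpendicular; simpl; intuition.
  - intros v a; exists (Line (pencil a) (negb (side a)) a0); simpl.
    unfold update, perpendicular; simpl.
    now destruct (side a).
  - intros v a b c d; simpl; unfold update, perpendicular; simpl.
    (* lying on one of two sides, the lines playing [x] and [y] are on the same
       one, opposite to that of [z] *)
    intros [[[H1 H2] [H3 H4]] [H5 H6]].
    split; [congruence |].
    destruct (side a), (side b), (side c), (side d); congruence.
Qed.

(** The variables [y_1, ..., y_n] can list all lines perpendicular to [s]: fix
    the pencil of [s] and the opposite side, and enumerate the positions. *)
Lemma lambda1_fails {A} (a0 : A) n (e : nat -> A) : 1 <= n ->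
  (forall a, exists i, 1 <= i <= n /\ e i = a) ->
  ~ holds (plane A a0) (lambda1 n).
Proof.
  intros Hn onto H.
  set (v := fun i => match i with
                     | 0 => Line 0 true a0
                     | _ => Line 0 false (e i)
                     end).
  destruct (proj1 (holds_lambda1 _ n Hn) H v) as [[k s a] [Hnew [Hk Hs]]].
  - intros [| i] Hi; [lia |]; now split.
  - simpl in Hk, Hs; subst k.
    destruct s; [congruence |].
    destruct (onto a) as [[| i] [Hi <-]]; [lia |].
    now apply (Hnew (S i) Hi).
Qed.

Theorem proposition4p1 : ~ finitely_axiomatizable SAPP.
Proof.
  intros [l [_ Hl]].
  set (N := S (list_max (map max_var l))).
  assert (model (plane nat 0) (fun p => In p l)) as infinite_plane.
  { apply Hl, sapp_model; apply nat_more_than. }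
  assert (model (plane (Fin.t (S N)) Fin.F1) (fun p => In p l)) as finite_plane.
  { intros p Hp.
    apply (@holds_transfer _ nat Fin.F1 0 fin_val N).
    - intros a b; apply Fin.to_nat_inj.
    - apply fin_more_than.
    - apply nat_more_than.
    - assert (Forall (fun k => k <= list_max (map max_var l)) (map max_var l))
        as bound by now apply list_max_le.
      rewrite Forall_forall in bound.
      specialize (bound _ (in_map max_var l p Hp)); unfold N; lia.
    - now apply infinite_plane. }
  apply (lambda1_fails Fin.F1 (S N) (fin_enum N) ltac:(lia) (fin_enum_onto N)).
  apply Hl in finite_plane.
  apply finite_plane; constructor; lia.
Qed.
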